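(* Let $X$ be a Tychonoff space and let $V$ be a vector subspace of the free locally convex space $L(X)$ (with the induced topology) which contains an infinite set $D$ of linearly independent vectors. Then: (1) the space $V$ is not a Baire space; (2) if $V$ is dominated by a metrizable locally convex topology (that is, there is a metrizable locally convex topology on $V$ finer than the topology induced from $L(X)$), then $V$ is not quasi-complete.
   Context: All vector spaces are real; all topological vector spaces are Hausdorff; ''lcs'' means locally convex space. For a Tychonoff space $X$, the free lcs $L(X)$ is a lcs together with a continuous map $i:X\to L(X)$ such that every continuous map $f$ from $X$ to a lcs $E$ gives rise to a unique continuous linear operator $\widehat f:L(X)\to E$ with $f=\widehat f\circ i$. It always exists and is unique; $i$ is a topological embedding and $i(X)$ is a Hamel basis of $L(X)$. A topological space is Baire if the intersection of every countable sequence of its dense open subsets is dense. A lcs $E$ is quasi-complete if every closed bounded subset of $E$ is complete. *)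

(* Defs.v *)
From HB Require Import structures.
From mathcomp Require Import all_boot all_order all_algebra.
From mathcomp Require Import all_classical all_reals all_analysis.

Set Implicit Arguments.
Unset Strict Implicit.
Unset Printing Implicit Defensive.

Import Order.TTheory GRing.Theory Num.Theory.
Import numFieldNormedType.Exports.

Local Open Scope classical_set_scope.
Local Open Scope ring_scope.

(* [tvsType R] is the type of locally convex spaces, without separation axiom.
   It also carries a uniformity which is only required to be compatible with
   the topology, not to be translation invariant; no definition below uses
   that uniformity. *)

Definition tychonoff_space (T : topologicalType) : Prop :=
  completely_regular_space T /\ hausdorff_space T.

Definition baire_space (T : topologicalType) : Prop :=
  forall U : (set T)^nat,
    (forall n, open (U n) /\ dense (U n)) -> dense (\bigcap_n U n).

Definition metrizable (R : realType) (T : topologicalType) : Prop :=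
  exists d : T -> T -> R,
    [/\ forall x y, d x y = 0 <-> x = y,
        forall x y, d x y = d y x,
        forall x y z, d x z <= d x y + d y z &
        forall x (A : set T), nbhs x A <->
          exists2 e, 0 < e & [set y | d x y < e] `<=` A].

Section LocallyConvex.
Context {R : realType}.

(* The pair (L, i) has the universal property of the free locally convex
   space over X, which determines it up to a unique isomorphism. *)
Definition free_lcs (X : topologicalType) (L : tvsType R) (i : X -> L) : Prop :=
  [/\ hausdorff_space L, continuous i &
      forall (E : tvsType R) (f : X -> E), hausdorff_space E -> continuous f ->
        exists! g : L -> E, [/\ linear g, continuous g & f = g \o i]].

Definition linearly_independent (E : lmodType R) (D : set E) : Prop :=
  forall (s : seq E) (c : E -> R),
    uniq s -> (forall x, x \in s -> D x) -> \sum_(x <- s) c x *: x = 0 ->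
    forall x, x \in s -> c x = 0.

Definition tvs_bounded (E : tvsType R) (B : set E) : Prop :=
  forall U : set E, nbhs 0 U ->
    exists r : R, forall t, r < t -> B `<=` [set t *: u | u in U].

Definition tvs_cauchy (E : tvsType R) (F : set_system E) : Prop :=
  forall U : set E, nbhs 0 U ->
    exists2 A, F A & forall x y, A x -> A y -> U (x - y).

Definition tvs_complete (E : tvsType R) (A : set E) : Prop :=
  forall F : set_system E, ProperFilter F -> F A -> tvs_cauchy F ->
    exists2 x, A x & F --> x.

Definition quasi_complete (E : tvsType R) : Prop :=
  forall B : set E, closed B -> tvs_bounded B -> tvs_complete B.

(* A finer topology on E is given as a second locally convex space E' together
   with a continuous linear bijection E' -> E. *)
Definition dominated_by_metrizable_lcs (E : tvsType R) : Prop :=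
  exists (E' : tvsType R) (phi : {linear E' -> E}),
    [/\ metrizable R E', bijective phi & continuous phi].

End LocallyConvex.

Section Subspace.
Context {R : realType} {L : tvsType R}.

Record subsp (V : submodClosed L) := Subsp {
  subsp_val :> L;
  subsp_valP : subsp_val \in V }.

Variable V : submodClosed L.

HB.instance Definition _ := [isSub for @subsp_val V].
HB.instance Definition _ := [Choice of subsp V by <:].
HB.instance Definition _ := [SubChoice_isSubLmodule of subsp V by <:].
HB.instance Definition _ :=
  Topological.copy (subsp V) (initial_topology (@subsp_val V)).

Lemma subsp_val_continuous : continuous (@subsp_val V).
Proof. exact: initial_continuous. Qed.

Lemma subsp_continuous (T : topologicalType) (f : T -> subsp V) :
  continuous (@subsp_val V \o f) -> continuous f.
Proof. exact: (@continuous_comp_initial _ _ _ (@subsp_val V)). Qed.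

Let subsp_add_continuous : continuous (fun x : subsp V * subsp V => x.1 + x.2).
Proof.
apply: subsp_continuous => -[x y].
apply: (@continuous_comp _ _ _
  (fun z : subsp V * subsp V => (val z.1, val z.2)) (fun z : L * L => z.1 + z.2)).
  apply: (@cvg_pair _ _ _ _ (nbhs (val x)) (nbhs (val y))).
  - apply: (cvg_comp (@fst _ _) (@subsp_val V)); first exact: cvg_fst.
    exact: subsp_val_continuous.
  - apply: (cvg_comp (@snd _ _) (@subsp_val V)); first exact: cvg_snd.
    exact: subsp_val_continuous.
exact: add_continuous.
Qed.

Let subsp_scale_continuous : continuous (fun z : R^o * subsp V => z.1 *: z.2).
Proof.
apply: subsp_continuous => -[k x].
apply: (@continuous_comp _ _ _
  (fun z : R^o * subsp V => (z.1, val z.2)) (fun z : R^o * L => z.1 *: z.2)).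
  apply: (@cvg_pair _ _ _ _ (nbhs (k : R^o)) (nbhs (val x))).
  - exact: cvg_fst.
  - apply: (cvg_comp (@snd _ _) (@subsp_val V)); first exact: cvg_snd.
    exact: subsp_val_continuous.
exact: scale_continuous.
Qed.

Let subsp_locally_convex : exists2 B : set_system (subsp V),
  (forall b, b \in B -> convex_set b) & basis B.
Proof.
have [B Bconvex [Bopen Bbasis]] := @locally_convex R L.
exists [set @subsp_val V @^-1` b | b in B].
  move=> _ /[!inE] -[b Bb <-] x y k /[!inE] /= bx b_y.
  by have /(_ b (mem_set Bb) (val x) (val y) k) := Bconvex; rewrite !inE; apply.
split; first by move=> _ [b Bb <-]; exists b => //; exact: Bopen.
move=> x A; rewrite nbhsE /= => -[_ [[U Uopen <-] Ux] UA].
have [b [Bb bx] bU] := Bbasis (val x) U (open_nbhs_nbhs (conj Uopen Ux)).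
exists (@subsp_val V @^-1` b); first by split => //; exists b.
by move=> z bz; apply/UA/bU.
Qed.

HB.instance Definition _ := PreTopologicalNmodule_isTopologicalNmodule.Build
  (subsp V) subsp_add_continuous.
HB.instance Definition _ := TopologicalNmodule_isTopologicalLmodule.Build
  R (subsp V) subsp_scale_continuous.
HB.instance Definition _ := PreTopologicalLmod_isTvs.Build R (subsp V)
  subsp_add_continuous subsp_scale_continuous subsp_locally_convex.
HB.instance Definition _ := Uniform_isTvs.Build R (subsp V)
  subsp_locally_convex.

End Subspace.

(* Main.v *)
(* The points of X span L, because L retracts linearly onto the span of i(X).
   Call v in L n-separated if n continuous functionals, with pairwise disjoint
   supports on X, do not vanish at v. This is an open condition. By complete
   regularity it holds for a combination of n points with nonzero coefficients,
   and it fails for a combination of fewer than n points. If a nonempty open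
   subset of V contained no n-separated vector, it would contain a vector with
   a support S of maximal size; perturbing it in an arbitrary direction e of V
   cannot enlarge S, so e lies in the span of S, and V is finite-dimensional.
   Hence n-separated vectors are dense in V for every n, while no vector is
   n-separated for all n, which refutes the Baire property. For (2) the same
   density statement in the metrizable topology yields a sequence that
   converges, by quasi-completeness, to a vector n-separated for all n. *)
Require Import Defs.
From HB Require Import structures.
From mathcomp Require Import all_boot all_order all_algebra.
From mathcomp Require Import all_classical all_reals all_analysis.

Set Implicit Arguments.
Unset Strict Implicit.
Unset Printing Implicit Defensive.

Import Order.TTheory GRing.Theory Num.Theory.
Import numFieldNormedType.Exports.

Local Open Scope classical_set_scope.
Local Open Scope ring_scope.

(** * Finite combinations of points and their span *)

Section FreeLCS.
Context {R : realType} {X : topologicalType} {L : tvsType R} (i : X -> L).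

(** [c] is total and vanishes off [s], so that combinations over different lists add pointwise; zero
    coefficients inside [s] are allowed. *)
Definition combination (c : X -> R) (s : seq X) (v : L) : Prop :=
  [/\ uniq s, forall x, x \notin s -> c x = 0 & v = \sum_(x <- s) c x *: i x].

Lemma combination_widen c s u v :
  combination c s v -> uniq u -> {subset s <= u} -> combination c u v.
Proof.
move=> [us cs ->] uu su; split=> //.
  by move=> x; apply: contraNeq => cx; apply: su; apply: contraNT cx => /cs ->.
rewrite [RHS](bigID (mem s)) /= [X in _ + X]big1 ?addr0; last first.
  by move=> x /cs ->; rewrite scale0r.
rewrite -[RHS]big_filter; apply: perm_big; apply: uniq_perm => //.
  exact: filter_uniq.
by move=> x; rewrite mem_filter /=; case xs: (x \in s) => //=; rewrite su.
Qed.

Lemma combination_narrow c s v :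
  combination c s v -> combination c [seq x <- s | c x != 0] v.
Proof.
move=> [us cs ->]; split; first exact: filter_uniq.
  move=> x; rewrite mem_filter; apply: contraNeq => cx; rewrite cx /=.
  by apply: contraNT cx => /cs ->.
rewrite big_filter [LHS](bigID (fun x => c x != 0)) /=.
rewrite [X in _ + X]big1 ?addr0//.
by move=> x /negPn/eqP ->; rewrite scale0r.
Qed.

Lemma combinationP a c d s u v w : combination c s v -> combination d u w ->
  combination (fun x => a * c x + d x) (undup (s ++ u)) (a *: v + w).
Proof.
move=> cv dw.
have uU := undup_uniq (s ++ u).
have [|_ c0 ->] := combination_widen cv uU.
  by move=> x xs; rewrite mem_undup mem_cat xs.
have [|_ d0 ->] := combination_widen dw uU.
  by move=> x xu; rewrite mem_undup mem_cat xu orbT.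
split=> //; first by move=> x xU; rewrite c0// d0// mulr0 addr0.
rewrite scaler_sumr -big_split /=; apply: eq_bigr => x _.
by rewrite scalerDl scalerA.
Qed.

Definition spanned : {pred L} :=
  [pred v | `[< exists c s, combination c s v >]].

Lemma spanned_submod_closed : GRing.submod_closed spanned.
Proof.
split.
  by apply/asboolP; exists (fun=> 0), [::]; split; rewrite ?big_nil.
move=> a v w /asboolP[c [s cv]] /asboolP[d [u dw]].
by apply/asboolP; do 2 eexists; exact: combinationP cv dw.
Qed.

HB.instance Definition _ :=
  GRing.isSubmodClosed.Build R L spanned spanned_submod_closed.

Lemma mem_spanned x : i x \in spanned.
Proof.
apply/asboolP; exists (fun y => (y == x)%:R), [:: x]; split=> //.
  by move=> y; rewrite inE => /negbTE ->.
by rewrite big_seq1 eqxx scale1r.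
Qed.

Lemma subsp_hausdorff (V : submodClosed L) :
  hausdorff_space L -> hausdorff_space (subsp V).
Proof.
move=> hL p q pq; apply: val_inj; apply: hL => A B Ap Bq.
have [] := pq (@subsp_val R L V @^-1` A) (@subsp_val R L V @^-1` B).
- exact: subsp_val_continuous.
- exact: subsp_val_continuous.
by move=> z [Az Bz]; exists (val z).
Qed.

Hypothesis freeL : free_lcs i.

Lemma free_lcs_extend (E : tvsType R) (f : X -> E) :
  hausdorff_space E -> continuous f ->
  exists2 g : {linear L -> E}, continuous g & forall x, g (i x) = f x.
Proof.
have [_ _ freeU] := freeL; move=> hE cf.
have [g [[lg cg fg] _]] := freeU E f hE cf.
pose gM := GRing.isLinear.Build _ _ _ _ g lg.
pose gL : {linear L -> E} := HB.pack g gM.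
by exists gL => // x; rewrite fg.
Qed.

(** Corestricting [i] to its span and extending gives [g]. Both the identity of [L] and [g] followed
    by the inclusion extend [i], so they agree by uniqueness. *)
Lemma free_lcs_spanned v : exists c s, combination c s v.
Proof.
have [hL ci freeU] := freeL.
pose j x : subsp spanned := Subsp (mem_spanned x).
have cj : continuous j by apply: subsp_continuous.
have [g cg gj] := free_lcs_extend (subsp_hausdorff (V := spanned) hL) cj.
have [h [_ hu]] := freeU L i hL ci.
have -> : v = val (g v).
  have h_id : h = id.
    by apply: hu; split=> [a x y|x|] //; exact: cvg_id.
  have h_g : h = val \o g.
    apply: hu; split=> //.
    - by move=> a x y; rewrite /comp linearP (linearP val).
    - move=> x; apply: continuous_comp; first exact: cg.
      exact: subsp_val_continuous.
    - by apply/funext => x /=; rewrite gj.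
  by rewrite -[LHS]/(id v) -h_id h_g.
by have /asboolP := valP (g v).
Qed.

End FreeLCS.

(** * Bump functions at finitely many points *)

(** Let [h x] be 1 at [x] and 0 at the other points of [s], and take the positive part of [h x]
    minus the sum of [|h y|] over the other [y] in [s]. Where the functions of [x] and [y] are both
    positive, [|h y| < h x] and [|h x| < h y], which is absurd. *)
Lemma disjoint_bumps (R : realType) (X : topologicalType) (s : seq X) :
  tychonoff_space X -> uniq s ->
  exists f : X -> X -> R, [/\ forall x, continuous (f x),
    {in s &, forall x y, f x y = (x == y)%:R} &
    {in s &, forall x y, x != y -> forall z, f x z * f y z = 0}].
Proof.
move=> [crX hX] us.
have sep x : exists h : X -> R, [/\ continuous h, h x = 1 &
    forall y, y \in s -> y != x -> h y = 0].
  have : uniform_separator [set x] [set` [seq y <- s | y != x]].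
    apply: crX; last by rewrite /= mem_filter eqxx.
    move/hausdorff_accessible: hX => /accessible_finite_set_closed; apply.
    exact: finite_seq.
  move=> /(uniform_separatorP (R := R))[h [ch _ h0 h1]].
  exists (fun y => 1 - h y); split.
  - by move=> z; apply: continuousB; [exact: cst_continuous|exact: ch].
  - by rewrite (h0 (h x)) ?subr0//; exists x.
  - move=> y ys yx; rewrite (h1 (h y)) ?subrr//; exists y => //=.
    by rewrite mem_filter yx.
have /choice[h hP] := sep.
pose k x z := h x z - \sum_(y <- s | y != x) `|h y z|.
have ck x : continuous (k x).
  move=> z; apply: continuousB; first by have [+ _ _] := hP x; exact.
  apply: (@cvg_big _ _ _ _ _ _ _ _ _ (fun y z => `|h y z|)) => [|y _].
    exact: add_continuous.
  by apply: cvg_norm; have [+ _ _] := hP y; exact.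
exists (fun x z => Num.max 0 (k x z)); split.
- by move=> x; apply: max_fun_continuous => //; exact: cst_continuous.
- move=> x y xs ys; rewrite /k; have [->|xy] := eqVneq x y.
    have [_ hy1 hy0] := hP y.
    rewrite hy1 big1_seq ?subr0; last first.
      move=> z /andP[zy zs]; have [_ _ ->] := hP z; rewrite ?normr0//.
      by rewrite eq_sym.
    by rewrite max_r.
  have [_ _ ->//] := hP x; last by rewrite eq_sym.
  by rewrite sub0r max_l// oppr_le0 sumr_ge0.
- have kle x y : y \in s -> y != x -> forall z, k x z <= h x z - `|h y z|.
    move=> ys yx z; rewrite /k lerD2l lerN2.
    rewrite -big_filter (bigD1_seq y) ?filter_uniq ?mem_filter ?ys ?yx//=.
    by rewrite lerDl sumr_ge0.
  move=> x y xs ys xy z.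
  have [kx|kx] := leP (k x z) 0; first by rewrite mul0r.
  have [ky|ky] := leP (k y z) 0; first by rewrite mulr0.
  have := lt_le_trans kx (kle x y ys _ z).
  have := lt_le_trans ky (kle y x xs _ z).
  rewrite xy eq_sym xy => /(_ isT) hy /(_ isT) hx.
  rewrite subr_gt0 in hx; rewrite subr_gt0 in hy.
  have := le_lt_trans (ler_norm _) (lt_le_trans hy (ler_norm _)).
  by rewrite ltNge (ltW hx).
Qed.

(** * Vectors separated by functionals with disjoint supports *)

Section Separated.
Context {R : realType} {X : topologicalType} {L : tvsType R} (i : X -> L).

(** Products are required to vanish only at the points [i x]: two nonzero functionals never have
    product zero on all of [L]. *)
Definition separated (n : nat) (v : L) : Prop :=
  exists g : 'I_n -> {linear L -> R^o}, [/\ forall j, continuous (g j),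
    forall j k, j != k -> forall x, g j (i x) * g k (i x) = 0 &
    forall j, g j v != 0].

Lemma separated_nbhs n v : separated n v -> nbhs v (separated n).
Proof.
move=> [g [cg dg gv]].
have : \forall w \near v, forall j, g j w != 0.
  by apply: filter_forall => j; apply: cvgr_neq0 (gv j); exact: cg.
by apply: filterS => w gw; exists g.
Qed.

Lemma separated_leq m n v : (n <= m)%N -> separated m v -> separated n v.
Proof.
move=> nm [g [cg dg gv]]; exists (fun j => g (widen_ord nm j)); split=> //.
move=> j k jk; apply: dg.
by apply: contraNneq jk => /(congr1 val)/= /val_inj ->.
Qed.

(** Each functional is nonzero at some point of [s], and disjointness of supports makes this choice
    of points injective. *)
Lemma separated_size n c s v : combination i c s v -> separated n v ->
  (n <= size s)%N.
Proof.
move=> [us _ ->] [g [_ dg gv]].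
have /choice[h hP] j : exists x, x \in s /\ g j (i x) != 0.
  apply: contrapT => /forallNP nx; have /negP := gv j; apply; apply/eqP.
  rewrite linear_sum big1_seq // => x /= xs.
  rewrite linearZ /=.
  have [->|gx] := eqVneq (g j (i x)) 0; first exact: scaler0.
  by case: (nx x).
have hinj : injective h.
  move=> j k hjk; apply: contrapT => /eqP jk.
  have /eqP := dg _ _ jk (h j); rewrite mulf_eq0 => /orP[|/eqP].
    by apply/negP; have [] := hP j.
  by rewrite hjk; apply/eqP; have [] := hP k.
have <- : size (codom h) = n by rewrite size_codom card_ord.
apply: uniq_leq_size; first exact/injectiveP.
by move=> _ /codomP[j ->]; have [] := hP j.
Qed.

(** The bumps at the points of [s] extend to continuous functionals, and each of them sends [v] to
    the coefficient of its point. *)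
Lemma combination_separated c s v : tychonoff_space X -> free_lcs i ->
  combination i c s v -> {in s, forall x, c x != 0} -> separated (size s) v.
Proof.
move=> tX freeL [us cs ->] c0.
have [f [cf fs df]] := disjoint_bumps R tX us.
have ext x : {g : {linear L -> R^o} |
    continuous g /\ forall z, g (i z) = f x z}.
  apply: cid; have [|g cg gf] := free_lcs_extend freeL (E := R^o) _ (cf x).
    exact: Rhausdorff.
  by exists g.
pose t := in_tuple s.
exists (fun j => sval (ext (tnth t j))); split=> [j|j k jk x|j].
- by case: (ext _) => g [].
- case: (ext _) => g [_ /= ->]; case: (ext _) => h [_ /= ->].
  apply: df; rewrite ?mem_tnth//; apply: contraNneq jk => /eqP.
  by rewrite !(tnth_nth x) nth_uniq.
- case: (ext _) => g [_ /= gf]; rewrite linear_sum.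
  have js : tnth t j \in s by exact: mem_tnth.
  rewrite (bigD1_seq (tnth t j))//= big1_seq ?addr0.
    by rewrite linearZ /= gf fs// eqxx scaler_eq0 oner_eq0 orbF c0.
  move=> x /andP[xj xs]; rewrite linearZ /= gf fs//.
  by rewrite eq_sym (negbTE xj) scaler0.
Qed.

End Separated.

(** * Dimension count and small perturbations *)

(** The coefficients of [n.+1] vectors of [D] form a matrix with [n] columns; a nonzero row in its
    left kernel is a linear relation between them. *)
Lemma linearly_independent_finite (R : realType) (E : lmodType R) (D : set E)
    (n : nat) (e : 'I_n -> E) : linearly_independent D ->
  (forall d, D d -> exists a : 'I_n -> R, d = \sum_j a j *: e j) ->
  finite_set D.
Proof.
move=> liD De; apply: contrapT => /(infinite_set_fset n.+1)[B BD nB].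
pose s := take n.+1 (finmap.enum_fset B).
have us : uniq s by apply: take_uniq; exact: finmap.fset_uniq.
have ss : size s = n.+1 by rewrite size_takel.
have sD d : d \in s -> D d by move=> /mem_take; exact: BD.
have /choice[a aP] d : exists a : 'I_n -> R, d \in s -> d = \sum_j a j *: e j.
  have [/sD/De[a ->]|_] := boolP (d \in s); first by exists a.
  by exists (fun=> 0).
pose A := \matrix_(k < n.+1, j < n) a (nth 0 s k) j.
have /rowV0Pn[u /sub_kermxP uA /negP] : kermx A != 0.
  rewrite kermx_eq0 /row_free; apply: contraTneq (rank_leq_col A) => ->.
  by rewrite ltnn.
apply; apply/eqP/rowP => k; rewrite mxE.
pose c d := u 0 (inord (index d s)).
have ck (l : 'I_n.+1) : c (nth 0 s l) = u 0 l.
  by rewrite /c index_uniq ?ss// inord_val.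
rewrite -ck; apply: (liD s) => //; last by rewrite mem_nth ?ss.
rewrite (big_nth 0) ss big_mkord.
transitivity (\sum_j (u *m A) 0 j *: e j); last first.
  by rewrite uA big1// => j _; rewrite mxE scale0r.
under [RHS]eq_bigr => j _ do rewrite mxE scaler_suml.
rewrite exchange_big /=; apply: eq_bigr => l _.
rewrite ck [in LHS](aP (nth 0 s l)) ?mem_nth ?ss// scaler_sumr.
by apply: eq_bigr => j _; rewrite mxE scalerA.
Qed.

Lemma filter_forall_seq (T : Type) (F : set_system T) (X : eqType) (s : seq X)
    (P : X -> T -> Prop) : Filter F ->
  {in s, forall x, \forall t \near F, P x t} ->
  \forall t \near F, {in s, forall x, P x t}.
Proof.
move=> FF; elim: s => [|x s IHs] Ps; first by apply: filterE.
have Px := Ps _ (mem_head x s).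
have {IHs} Ps' : \forall t \near F, {in s, forall x, P x t}.
  by apply: IHs => y ys; apply: Ps; rewrite inE ys orbT.
apply: filterS2 Px Ps' => t Pxt Pst y.
by rewrite inE => /predU1P[->|]//; exact: Pst.
Qed.

(** The neighbourhood of 0 is punctured so that a nonzero [t] can be picked from it. *)
Lemma cvg_affine0 (R : realType) (E : tvsType R) (e w : E) :
  t *: e + w @[t --> (0 : R^o)^'] --> w.
Proof.
rewrite -[X in _ --> X]add0r -[X in _ --> X + _](scale0r e).
apply: (continuous2_cvg _ (h := fun x y : E => x + y)) _ (cvg_cst w).
  exact: (add_continuous (0 *: e, w)).
apply: (continuous2_cvg _ (h := fun (a : R^o) (x : E) => a *: x)) _ (cvg_cst e).
  exact: (scale_continuous (0 : R^o, e)).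
exact: cvg_within.
Qed.

(** * Density of separated vectors *)

Section Density.
Context {R : realType} {X : topologicalType} {L : tvsType R} (i : X -> L).
Context (tychX : tychonoff_space X) (freeL : free_lcs i).

(** Openness refers to the topology of [E], so that the statement serves both the induced topology
    on the subspace and the metrizable one above it. *)
Lemma separated_dense (D : set L) (E : tvsType R) (phi : {linear E -> L})
    (O : set E) (n : nat) :
  linearly_independent D -> infinite_set D -> D `<=` range phi ->
  open O -> O !=set0 -> exists2 w, O w & separated i n (phi w).
Proof.
move=> liD infD Dphi oO [w0 Ow0]; apply: contrapT => /forall2NP nsep.
(* [P m] says that some vector of [O] has a support of size [m]; such sizes are bounded by [n], so a
   maximal one exists. *)
pose P m := `[< exists w c s, [/\ O w, combination i c s (phi w),
  {in s, forall x, c x != 0} & size s = m] >].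
have Pcomb w c s : O w -> combination i c s (phi w) ->
    P (size [seq x <- s | c x != 0]).
  move=> Ow /combination_narrow cw; apply/asboolP.
  exists w, c, [seq x <- s | c x != 0]; split=> //.
  by move=> x; rewrite mem_filter => /andP[].
have exP : exists m, P m.
  have [c [s cw]] := free_lcs_spanned freeL (phi w0).
  by eexists; exact: Pcomb cw.
have ubP m : P m -> (m <= n)%N.
  move=> /asboolP[w [c [s [Ow cw c0 <-]]]]; rewrite leqNgt; apply/negP => ns.
  have /(_ w)[] := nsep; first by [].
  move=> nw; apply: nw; apply: separated_leq (ltnW ns) _.
  exact: combination_separated cw c0.
have [m /asboolP[w [c [s [Ow cw c0 sm]]]] maxm] := ex_maxnP exP ubP.
have spans e : exists b : X -> R, phi e = \sum_(x <- s) b x *: i x.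
  have [d [u de]] := free_lcs_spanned freeL (phi e).
  have d0 y : y \notin s -> d y = 0.
    move=> ys; apply: contrapT => /eqP dy.
    (* For small nonzero [t], the vector [t *: e + w] stays over [O], keeps nonzero coefficients on
       [s] and gains one at [y], against maximality. *)
    have near_O : \forall t \near (0 : R^o)^', O (t *: e + w).
      exact: (cvg_affine0 e (open_nbhs_nbhs (conj oO Ow))).
    have near_c : \forall t \near (0 : R^o)^',
        {in s, forall x, t * d x + c x != 0}.
      apply: filter_forall_seq => x xs.
      apply: (cvgr_neq0 (c x)); last exact: c0.
      exact: (cvg_affine0 (E := R^o)).
    have [t [t0 [Ot ct]]] := filter_ex (filterI (nbhs_dnbhs_neq (0 : R^o))
      (filterI near_O near_c)).
    have := combinationP t de cw; rewrite -linearP => /(Pcomb _ _ _ Ot)/maxm.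
    apply/negP; rewrite -ltnNge -sm -[(size s).+1]/(size (y :: s)).
    apply: uniq_leq_size; first by rewrite /= ys; have [->] := cw.
    move=> x; rewrite inE mem_filter mem_undup mem_cat => /predU1P[->|xs].
      have [_ cs _] := cw; rewrite cs// addr0 mulf_neq0//=.
      have [_ du _] := de; suff -> : y \in u by [].
      by apply: contraNT dy => /du ->.
    by rewrite ct// xs orbT.
  exists d; have [us _ _] := cw.
  have [|_ _ ->//] := combination_widen (combination_narrow de) us.
  by move=> x; rewrite mem_filter => /andP[dx _]; apply: contraNT dx => /d0 ->.
(* All of [D] now lies in the span of the finitely many points of [s]. *)
apply: infD; pose t := in_tuple s.
apply: (linearly_independent_finite (e := fun j => i (tnth t j)) liD).
move=> _ /Dphi[e _ <-]; have [b ->] := spans e.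
by exists (fun j => b (tnth t j)); rewrite big_tnth.
Qed.

End Density.

(** * Cauchy sequences and quasi-completeness *)

Section Tvs.
Context {R : realType} {E : tvsType R}.

Lemma addl_continuous (p : E) : continuous (fun x => p + x).
Proof.
move=> x.
apply: (continuous2_cvg _ (h := fun a b : E => a + b)) (cvg_cst p) cvg_id.
exact: (add_continuous (p, x)).
Qed.

Lemma nbhs0_addl (p : E) (A : set E) : nbhs p A -> nbhs 0 [set x | A (p + x)].
Proof. by have := @addl_continuous p 0 A; rewrite addr0. Qed.

Lemma nbhs0_sub (U : set E) : nbhs 0 U ->
  exists2 W : set E, nbhs 0 W & forall x y, W x -> W y -> U (x - y).
Proof.
move=> U0; have := @sub_continuous E (0, 0) U; rewrite /= subr0 => /(_ U0).
move=> [[A B] /= [A0 B0] ABU]; exists (A `&` B); first exact: filterI.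
by move=> x y [Ax _] [_ By]; exact: (ABU (x, y)).
Qed.

Lemma nbhs0_scale (U : set E) : nbhs 0 U ->
  exists2 W : set E, nbhs 0 W &
    \forall t \near (0 : R^o), forall x, W x -> U (t *: x).
Proof.
move=> U0; have := @scale_continuous R E (0, 0) U.
rewrite /= scale0r => /(_ U0).
move=> [[A B] /= [A0 B0] ABU]; exists B => //.
by apply: filterS A0 => t At x Bx; exact: (ABU (t, x)).
Qed.

(** Differences are compared with neighbourhoods of 0, as in [tvs_cauchy], rather than through the
    uniformity of [E]. *)
Definition cauchy_sequence (s : E^nat) : Prop := forall U, nbhs 0 U ->
  exists N, forall j k, (N <= j)%N -> (N <= k)%N -> U (s j - s k).

(** A point of the closure is close to some term, which is close to one of the terms up to [N];
    these finitely many terms are absorbed together. *)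
Lemma cauchy_closure_bounded (s : E^nat) :
  cauchy_sequence s -> tvs_bounded (closure (range s)).
Proof.
move=> cs U U0.
have [U1 U10 U1U] := nbhs0_sub U0; have [U2 U20 U2U1] := nbhs0_sub U10.
have [W W0 WU2] := nbhs0_scale U20; have [N sN] := cs W W0.
have near_s : \forall t \near (0 : R^o)^',
      {in iota 0 N.+1, forall k, U2 (t *: s k)}.
  apply: filter_forall_seq => k _.
  have near_sk : \forall t \near (0 : R^o)^', U2 (t *: s k + 0).
    exact: (cvg_affine0 (s k) U20).
  by apply: filterS near_sk => t; rewrite addr0.
have : nbhs (0 : R^o) [set t | t != 0 ->
    {in iota 0 N.+1, forall k, U2 (t *: s k)} /\ forall x, W x -> U2 (t *: x)].
  exact: (filterI near_s (cvg_within _ WU2)).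
(* If [t] exceeds [e^-1], then [t^-1] lies in the ball of radius [e]. *)
move=> /nbhs_ballP[e e0 eP]; exists e^-1 => t et x xcl.
have t0 : 0 < t by apply: lt_trans et; rewrite invr_gt0.
have [||sU WU] := eP t^-1; last 1 first.
- exists (t^-1 *: x); last by rewrite scalerA mulfV ?gt_eqF// scale1r.
  have [_ [[j _ <-] xj]] : range s `&` [set y | W (x - y)] !=set0.
    apply: xcl; have := @sub_continuous E (x, x) W; rewrite /= subrr => /(_ W0).
    move=> [[A B] /= [Ax Bx] ABW]; apply: filterS Bx => y By.
    by apply: (ABW (x, y)); split=> //=; exact: nbhs_singleton.
  (* Either [k] is [j] and [s k - s j] vanishes, or [k] is [N] and the Cauchy condition applies. *)
  pose k := minn j N.
  have -> : x = (x - s j) - ((s k - s j) - s k).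
    by rewrite [s k - s j]addrC addrK opprK subrK.
  rewrite scalerBr; apply: U1U.
    rewrite -[_ *: _]subr0; apply: U2U1; first exact: WU.
    exact: nbhs_singleton.
  rewrite scalerBr; apply: U2U1.
    apply: WU; rewrite /k; case: (leqP j N) => jN; last exact/sN/ltnW.
    by rewrite subrr; exact: nbhs_singleton.
  by apply: sU; rewrite mem_iota add0n ltnS geq_minr.
- rewrite -ball_normE /= sub0r normrN gtr0_norm ?invr_gt0//.
  by rewrite -[e]invrK ltf_pV2 ?posrE ?invr_gt0.
- by rewrite invr_eq0 gt_eqF.
Qed.

Lemma quasi_complete_cvg (s : E^nat) : quasi_complete E -> cauchy_sequence s ->
  exists x : E, s @ \oo --> x.
Proof.
move=> qcE cs.
have sF : ProperFilter (s @ \oo) by exact: fmap_proper_filter.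
have cB := closed_closure (A := range s).
have [||x _ sx] := qcE _ cB (cauchy_closure_bounded cs) _ sF; last by exists x.
  by exists 0%N => // k _; apply: subset_closure; exists k.
move=> U /cs[N sN]; exists (s @` [set k | (N <= k)%N]).
  by exists N => // k Nk; exists k.
by move=> _ _ [j Nj <-] [k Nk <-]; exact: sN.
Qed.

Lemma metrizable_nbhs0_base : metrizable R E ->
  exists2 N : (set E)^nat, forall k, nbhs 0 (N k) &
    forall U, nbhs 0 U -> exists k, N k `<=` U.
Proof.
move=> [d [_ _ _ dP]]; exists (fun k => [set y | d 0 y < k.+1%:R^-1]).
  by move=> k; apply/dP; exists k.+1%:R^-1.
move=> U /dP[e e0 eU].
have [k ke] := filter_ex (near_infty_natSinv_lt (PosNum e0)).
by exists k => y /= dy; apply: eU; exact: lt_trans dy ke.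
Qed.

End Tvs.

(** * The two negative results *)

Section Main.
Context {R : realType} {X : topologicalType} {L : tvsType R} (i : X -> L).
Context (tychX : tychonoff_space X) (freeL : free_lcs i).
Context (V : submodClosed L) (D : set L).
Context (DV : forall x, D x -> x \in V) (infD : infinite_set D).
Context (liD : linearly_independent D).

Lemma not_always_separated v : exists n, ~ separated i n v.
Proof.
have [c [s cv]] := free_lcs_spanned freeL v.
by exists (size s).+1 => /(separated_size cv); rewrite ltnn.
Qed.

Lemma subspace_not_baire : ~ baire_space (subsp V).
Proof.
pose U n : set (subsp V) := [set v | separated i n (val v)].
have Dval : D `<=` range (val : subsp V -> L).
  by move=> x /DV xV; exists (Subsp xV).
have Uod n : open (U n) /\ dense (U n).
  split.
    rewrite openE => v Uv; rewrite /interior.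
    exact: (subsp_val_continuous (separated_nbhs Uv)).
  move=> O O0 oO.
  have [w Ow sw] := separated_dense tychX freeL n liD infD Dval oO O0.
  by exists w.
move=> /(_ U Uod setT)[|//|v [_ Uv]].
- by exists 0.
- exact: openT.
- by have [n] := not_always_separated (val v); apply; exact: Uv.
Qed.

(** A limit is reached from [v] through a late term: [x] will be that term minus [v], and [y] that
    term minus the limit. *)
Lemma separated_nbhs_sub n (v : subsp V) : separated i n (val v) ->
  exists2 U : set (subsp V), nbhs 0 U &
    forall x y, U x -> U y -> separated i n (val (v + (x - y))).
Proof.
move=> /separated_nbhs /subsp_val_continuous /nbhs0_addl /nbhs0_sub[U U0 Usep].
by exists U.
Qed.

(* The metrizable space [E] need not be complete, so the Baire theorem does not
   apply to it. The sequence [s] built below is Cauchy in [E], but its limit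
   [v] is taken in [V], where only the images of the neighbourhoods [(p k).2]
   can be controlled. *)
Lemma metrizable_dominated_not_quasi_complete :
  dominated_by_metrizable_lcs (subsp V) -> ~ quasi_complete (subsp V).
Proof.
move=> [E [phi [metE bij_phi cphi]]] qcV.
have [N N0 Nbase] := metrizable_nbhs0_base metE.
pose psi : {linear E -> L} := (val : {linear subsp V -> L}) \o phi.
have Dpsi : D `<=` range psi.
  move=> x /DV xV; have [g _ gK] := bij_phi.
  by exists (g (Subsp xV)); rewrite //= gK.
(* A pair [p] stands for the open set [p.1 + p.2], in which all later terms of the sequence will
   stay. *)
pose good (p : E * set E) := open p.2 /\ p.2 0.
(* In order after [good q]: the sets are nested; their differences lie in [N k], for the Cauchy
   property; separation survives perturbations from a neighbourhood [U] in the topology of [V]. *)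
pose step k (p q : E * set E) := [/\ good q,
  forall x, q.2 x -> p.2 (- p.1 + (q.1 + x)),
  forall x y, q.2 x -> q.2 y -> N k (x - y) &
  exists2 U : set (subsp V), nbhs 0 U /\ (forall x, q.2 x -> U (phi x)) &
    forall x y, U x -> U y -> separated i k (val (phi q.1 + (x - y)))].
have stepP k p : good p -> exists q, step k p q.
  move: p => [s W] [/= oW W0].
  have oO : open [set x | W (- s + x)].
    by apply: open_comp => // x _; exact: addl_continuous.
  have O0 : [set x | W (- s + x)] !=set0 by exists s; rewrite /= addNr.
  have [s' Os' /separated_nbhs_sub[U U0 Usep]] :=
    separated_dense tychX freeL k liD infD Dpsi oO O0.
  have [N' N'0 N'N] := nbhs0_sub (N0 k).
  have W1 := nbhs0_addl (open_nbhs_nbhs (conj oO Os')).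
  have pU : nbhs 0 (phi @^-1` U) by apply: cphi; rewrite linear0.
  pose A := [set x | W (- s + (s' + x))] `&` (N' `&` phi @^-1` U).
  exists (s', A^°); have sub : A^° `<=` A := @interior_subset _ A.
  split=> /=.
  - split; first exact: open_interior.
    by apply: filterI => //; exact: filterI.
  - by move=> x /sub[].
  - by move=> x y /sub[_ [N'x _]] /sub[_ [N'y _]]; exact: N'N.
  - by exists U => //; split=> // x /sub[_ []].
have /choice[f fP] (kp : nat * (E * set E)) :
    exists q, good kp.2 -> step kp.1 kp.2 q.
  have [/stepP-/(_ kp.1)[q]|] := pselect (good kp.2); first by exists q.
  (* A default value for pairs that are not good; the recursion below never meets it. *)
  by exists kp.2.
pose p := fix p k := if k is k'.+1 then f (k', p k') else (0, setT).
have gp k : good (p k).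
  by elim: k => [|k /(fP (k, _))[]//]; split; [exact: openT|].
have sp k : step k (p k) (p k.+1) by exact: (fP (k, p k) (gp k)).
pose s k := (p k).1.
have nested k m x : (p (m + k)%N).2 x -> (p k).2 (- s k + (s (m + k)%N + x)).
  elim: m x => [|m IHm] x; first by rewrite addKr.
  rewrite addSn => px; have [_ /(_ _ px)/IHm + _ _] := sp (m + k)%N.
  by rewrite addNKr.
have nested_s k j : (k <= j)%N -> (p k).2 (- s k + s j).
  move=> kj; have := nested k (j - k)%N 0; rewrite subnK// addr0; apply.
  by have [] := gp j.
have cs : cauchy_sequence (phi \o s).
  move=> U U0; have [|k NkU] := Nbase (phi @^-1` U).
    by apply: cphi; rewrite linear0.
  (* [step k] constrains the neighbourhood of index [k.+1]; both terms are compared with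
     [s k.+1]. *)
  exists k.+1 => j l /nested_s pj /nested_s pl /=; rewrite -linearB.
  apply: NkU; have [_ _ subN _] := sp k; have := subN _ _ pj pl.
  by rewrite opprD opprK addrACA addNr add0r.
have [v sv] := quasi_complete_cvg qcV cs.
have [n] := not_always_separated (val v); apply.
have [_ _ _ [U [U0 pU] Usep]] := sp n.
have Uv : nbhs v [set x | U (- v + x)].
  by have := @addl_continuous _ _ (- v) v U; rewrite addNr; exact.
have [k [nk Uk]] := filter_ex (filterI (nbhs_infty_ge n.+1) (sv _ Uv)).
(* The term [s k] cancels: its distance to [s n.+1] is controlled by nesting, its distance to [v] by
   convergence. *)
rewrite -[v](_ : phi (s n.+1) + (phi (- s n.+1 + s k) - (- v + phi (s k))) = v).
  exact: Usep (pU _ (nested_s _ _ nk)) Uk.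
rewrite [- _ + s k]addrC linearB opprD opprK addrA.
by rewrite [phi (s n.+1) + _]addrC subrK addrC subrK.
Qed.

End Main.

Theorem theorem5p2 (R : realType) (X : topologicalType) (L : tvsType R)
    (i : X -> L) (V : submodClosed L) (D : set L) :
  tychonoff_space X -> free_lcs i ->
  (forall x, D x -> x \in V) -> infinite_set D -> linearly_independent D ->
  ~ baire_space (subsp V) /\
  (dominated_by_metrizable_lcs (subsp V) -> ~ quasi_complete (subsp V)).
Proof.
move=> tychX freeL DV infD liD; split.
  exact: (subspace_not_baire tychX freeL DV infD liD).
exact: (metrizable_dominated_not_quasi_complete tychX freeL DV infD liD).
Qed.
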